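(* Let $X$ be a LOTS, let $I$ be a set of indices and let $j\in I$. Let $\mathcal{L}_{X^I}$ be a nest on $X^I$ which is weakly $T_0$-separating with respect to the $j$-th variable and which satisfies the condition: whenever $L\in\mathcal{L}_{X^I}$ and $(x_i)_{i\in I}\in X^I$ with $(x_i)_{i\in I}\notin L$, then $x_j\notin\pi_j(L)$. Then $\pi_j(\mathcal{L}_{X^I})=\{\pi_j(L) : L\in\mathcal{L}_{X^I}\}$ is a $T_0$-separating nest on $X$.
   Context: A LOTS is a linearly ordered topological space (topology equal to the order topology of a linear order). A nest on a set is a family of its subsets that is linearly ordered by inclusion. $\pi_j:X^I\to X$ denotes the $j$-th canonical projection. A nest $\mathcal{L}_{X^I}$ on $X^I$ is weakly $T_0$-separating with respect to the $j$-th variable if for all $(x_i)_{i\in I},(y_i)_{i\in I}\in X^I$ with $x_j\neq y_j$ there exists $L\in\mathcal{L}_{X^I}$ such that $(x_i)_{i\in I}\in L$ and $(y_i)_{i\in I}\notin L$, or $(y_i)_{i\in I}\in L$ and $(x_i)_{i\in I}\notin L$. A collection $\mathcal{S}$ of subsets of $X$ is $T_0$-separating if for all $x\neq y$ in $X$ there exists $S\in\mathcal{S}$ such that $x\in S$ and $y\notin S$, or $y\in S$ and $x\notin S$. *)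

(* Defs.v *)
From mathcomp Require Export all_boot all_order.
From mathcomp Require Export all_classical order_topology.

Set Implicit Arguments.
Unset Strict Implicit.
Unset Printing Implicit Defensive.

Local Open Scope classical_set_scope.

Definition nest (T : Type) (L : set (set T)) : Prop := total_on L subset.

Definition T0_separating (T : Type) (S : set (set T)) : Prop :=
  forall x y : T, x <> y ->
    exists2 A, S A & (A x /\ ~ A y) \/ (A y /\ ~ A x).

Definition weakly_T0_separating (I X : Type) (j : I) (L : set (set (I -> X))) :
    Prop :=
  forall x y : I -> X, x j <> y j ->
    exists2 A, L A & (A x /\ ~ A y) \/ (A y /\ ~ A x).

(* Main.v *)
Require Import Defs.

Set Implicit Arguments.
Unset Strict Implicit.
Unset Printing Implicit Defensive.

Local Open Scope classical_set_scope.

(** Taking images preserves inclusion, so the projections of a nest form a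
    nest. For separation, two distinct points [a] and [b] of [X] are viewed as
    constant families, which differ in the [j]-th coordinate; some member [A]
    of the nest contains exactly one of them. The projection of [A] contains
    the coordinate of the family in [A], and the hypothesis on projections says
    precisely that it misses the coordinate of the other one. *)

Theorem theorem8 (d : Order.disp_t) (X : orderTopologicalType d) (I : Type)
    (j : I) (L : set (set (I -> X)))
    (L_nest : nest L)
    (L_sep : weakly_T0_separating j L)
    (L_proj : forall (A : set (I -> X)) (x : I -> X),
      L A -> ~ A x -> ~ (proj j @` A) (x j)) :
  nest [set proj j @` A | A in L] /\ T0_separating [set proj j @` A | A in L].
Proof.
split.
  move=> _ _ [A LA <-] [B LB <-].
  by case: (L_nest A B LA LB) => AB; [left|right]; exact: image_subset.
move=> a b ab; have [A LA sepA] := L_sep (fun=> a) (fun=> b) ab.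
exists (proj j @` A); first by exists A.
case: sepA => -[Ain Anotin]; [left|right]; split.
- by exists (fun=> a).
- exact: (L_proj A (fun=> b)).
- by exists (fun=> b).
- exact: (L_proj A (fun=> a)).
Qed.
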